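(* Let $H$ be a graph with at least one edge. There exists a function $\overline{q}\colon(0,1)\to(0,1)$ with $\lim_{p\to0}\overline{q}(p)/p<1$ such that whenever $\overline{q}(p)<q\le p$, the constant graphon $W\equiv q$ is the unique minimizer for $\mathsf{LT}_p(H,q)$. Furthermore, if $H$ is not bipartite, then there exists a function $\underline{q}\colon(0,1)\to(0,1)$ with $\lim_{p\to0}\underline{q}(p)/p>0$ such that whenever $0\le q<\underline{q}(p)$, the constant graphon $W\equiv q$ does not minimize $\mathsf{LT}_p(H,q)$.
   Context: Graphs are finite and simple; $V(H),E(H)$ are the vertex and edge sets and $e(H)=|E(H)|$. A graphon is a symmetric measurable function $W\colon[0,1]^2\to[0,1]$, and $t(H,W):=\int_{[0,1]^{V(H)}}\prod_{ij\in E(H)}W(x_i,x_j)\prod_{i\in V(H)}dx_i$. For a function $f$, write $\mathbb{E}[f(W)]:=\int_{[0,1]^2}f(W(x,y))\,dx\,dy$. For $0<p<1$ and $x\in[0,1]$, $I_p(x):=x\log\frac{x}{p}+(1-x)\log\frac{1-x}{1-p}$ (with $0\log0=0$). For $0\le q\le p$, $\mathsf{LT}_p(H,q)$ denotes the variational problem (and also its value): minimize $\mathbb{E}[I_p(W)]$ over all graphons $W$ subject to $t(H,W)\le q^{e(H)}$. Graphons are identified if they differ on a set of measure zero or by a measure-preserving transformation of $[0,1]$ (i.e. $W$ is identified with $W^\sigma(x,y)=W(\sigma(x),\sigma(y))$ for $\sigma\colon[0,1]\to[0,1]$ measure-preserving); uniqueness of minimizers is understood up to this identification. *)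

(* Defs.v *)
From HB Require Import structures.
From Stdlib Require Import Relation_Operators.
From mathcomp Require Import all_boot all_order all_algebra.
From mathcomp Require Import all_classical all_reals all_analysis.

Set Implicit Arguments.
Unset Strict Implicit.
Unset Printing Implicit Defensive.

Import Order.TTheory GRing.Theory Num.Theory.
Import numFieldNormedType.Exports.

Local Open Scope classical_set_scope.
Local Open Scope ring_scope.

Section TupleProbability.
Context d (T : measurableType d) (R : realType).

Definition cons_pair n (z : T * n.-tuple T) : n.+1.-tuple T :=
  [the n.+1.-tuple T of z.1 :: z.2].

Lemma measurable_cons_pair n : measurable_fun setT (@cons_pair n).
Proof. exact: measurable_cons. Qed.

HB.instance Definition _ n := isMeasurableFun.Build _ _ _ _ (@cons_pair n)
  (@measurable_cons_pair n).

(* The product measure P^n on n-tuples: the library only has binary products,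
   so P^(n+1) is the image of P \x P^n under (x, t) |-> x :: t. *)
Fixpoint tuple_prob (P : probability T R) n : probability (n.-tuple T) R :=
  match n with
  | 0 => \d_ [tuple]
  | k.+1 => distribution (P \x tuple_prob P k)%E (@cons_pair k)
  end.

End TupleProbability.

Section Graphons.
Context (R : realType).
Implicit Types (U W : R * R -> R) (p q : R).

Definition I01 : set R := `[0, 1]%classic.
Definition sq01 : set (R * R) := I01 `*` I01.

(* Lebesgue measure on [0,1], as a probability measure on R. *)
Definition mu01 : probability (measurableTypeR R) R := uniform_prob (@ltr01 R).
Definition mu01sq : probability (measurableTypeR R * measurableTypeR R)%type R :=
  (mu01 \x mu01)%E.

(* Only the values on [0,1]^2 matter. *)
Definition is_graphon W : Prop :=
  [/\ measurable_fun sq01 W,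
      forall x y, I01 x -> I01 y -> 0 <= W (x, y) <= 1 &
      forall x y, I01 x -> I01 y -> W (x, y) = W (y, x)].

Definition measure_preserving01 (s : R -> R) : Prop :=
  [/\ measurable_fun I01 s,
      forall x, I01 x -> I01 (s x) &
      forall A : set R, measurable A -> mu01 (I01 `&` s @^-1` A) = mu01 A].

Definition graphon_step U W : Prop :=
  [/\ is_graphon U, is_graphon W &
      U = W %[ae mu01sq in sq01] \/
      exists2 s : R -> R, measure_preserving01 s &
        forall x y, I01 x -> I01 y -> W (x, y) = U (s x, s y)].

Definition graphon_equiv : (R * R -> R) -> (R * R -> R) -> Prop :=
  clos_refl_sym_trans _ graphon_step.

Definition mean (f : R -> R) W : R := \int[mu01sq]_(z in sq01) f (W z).

(* [ln 0 = 0] in the library, so the convention 0 log 0 = 0 holds. *)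
Definition Ip p (x : R) : R :=
  x * ln (x / p) + (1 - x) * ln ((1 - x) / (1 - p)).

Section Density.
Context (V : finType) (E : rel V).

(* Each edge ij of the graph occurs once, oriented along [enum V]. *)
Definition edges : {set V * V} :=
  [set ij | E ij.1 ij.2 && (enum_rank ij.1 < enum_rank ij.2)%N].

Definition vertex_coord (x : #|V|.-tuple R) (i : V) : R := tnth x (enum_rank i).

Definition cube01 : set (#|V|.-tuple R) := [set x | forall i, I01 (vertex_coord x i)].

Definition hom_density W : R :=
  \int[tuple_prob mu01 #|V|]_(x in cube01)
    \prod_(ij in edges) W (vertex_coord x ij.1, vertex_coord x ij.2).

Definition LT_feasible q W : Prop :=
  is_graphon W /\ hom_density W <= q ^+ #|edges|.

Definition LT_minimizer p q W : Prop :=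
  LT_feasible q W /\
  forall U, LT_feasible q U -> mean (Ip p) W <= mean (Ip p) U.

Definition LT_unique_minimizer p q W : Prop :=
  LT_minimizer p q W /\
  forall U, LT_minimizer p q U -> graphon_equiv U W.

End Density.
End Graphons.

Definition bipartite (V : finType) (E : rel V) : Prop :=
  exists A : {set V}, forall u v, E u v -> (u \in A) != (v \in A).

(* Main.v *)
Require Import Defs.
From mathcomp Require Import all_boot all_order all_algebra.
From mathcomp Require Import all_classical all_reals all_analysis.
From mathcomp Require Import measurable_realfun ring lra.
Import Order.TTheory GRing.Theory Num.Theory.
Import numFieldNormedType.Exports.
Local Open Scope classical_set_scope.
Local Open Scope ring_scope.

(** Near p: put m = min(x, p) / q - 1, which lies in [-1, 1] as soon as
    q <= p <= 2 q.  With n edges and C = 4^n, a product of weights satisfies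
    prod_e w_e >= q^n (1 + sum_e (m_e - C m_e^2)): up to second order in the
    deviations, a product is at least its linear part ([prod_ge_penalty]).
    The two coordinates of any edge are distributed by the same product measure
    ([integral_tuple_prob_pair]), so integrating over a feasible graphon W gives E[m] <= C E[m^2], written here as E[h(W)] >= 1 for
    the nonnegative function h = 1 - m + C m^2 ([mean_penalty_ge1]): a feasible
    graphon can exceed q on average only at the price of variance.

    On the entropy side I_p is strictly convex with curvature of order 1 / p
    below p, while the absolute value of its slope at q is at most
    2 (p / q - 1) when p <= 1/2.  Hence for q / p close to 1 the quadratic gain
    pays for the linear loss: gap(x) = I_p(x) - I_p(q) - q s (h(x) - 1), with s
    minus the slope of I_p at q, is positive except at x = q ([gap_gt0]).
    Together,
    E[I_p(W)] = I_p(q) + E[gap(W)] + q s (E[h(W)] - 1) >= I_p(q) + E[gap(W)],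
    and equality forces W = q almost everywhere ([unique_minimizer_cst]).
    How close q / p must be to 1 depends only on the number of edges once
    p <= 1/2; for larger p the range of q may be taken empty, since only the
    limit p -> 0 constrains the threshold.

    Near 0: if H is not bipartite, the graphon equal to p between the halves of
    [0,1] and to 0 inside each half has H-density zero, hence is feasible for
    every q >= 0, and costs I_p(0) / 2.  For q < p / 100 the constant q costs
    more ([Ip_near0_gt]). *)

(** * A second-order lower bound for products *)

Section ProductBound.
Set Implicit Arguments.
Unset Strict Implicit.

(** Expansion of sum_i (c + g i)^2; it controls the cross term c * sum_i g i. *)
Lemma sum_sqr_shift_ge0 (R : realFieldType) (I : Type) (s : seq I) (g : I -> R)
    (c : R) :
  0 <= (size s)%:R * c ^+ 2 + 2 * c * (\sum_(i <- s) g i)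
       + \sum_(i <- s) g i ^+ 2.
Proof.
elim: s => [|i s IH]; first by rewrite !big_nil /=; lra.
rewrite !big_cons /= -natr1.
have := sqr_ge0 (c + g i).
lra.
Qed.

(** Induction on [s].  A new factor 1 + g <= 2 at most doubles the quadratic
    error and creates the cross term g * sum_i g i, which
    [sum_sqr_shift_ge0] bounds by squares; the constant 4 ^ size s absorbs
    both. *)
Lemma prod1D_ge_quadratic (R : realFieldType) (I : Type) (s : seq I) (g : I -> R) :
  (forall i, -1 <= g i <= 1) ->
  1 + \sum_(i <- s) g i - 4 ^+ size s * \sum_(i <- s) g i ^+ 2
    <= \prod_(i <- s) (1 + g i).
Proof.
move=> g1; elim: s => [|i s IH]; first by rewrite !big_nil; lra.
rewrite !big_cons /= exprS.
have /andP[gN gP] := g1 i.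
set S := \sum_(j <- s) g j in IH *; set Q := \sum_(j <- s) g j ^+ 2 in IH *.
have Q0 : 0 <= Q by apply: sumr_ge0 => j _; exact: sqr_ge0.
have := sum_sqr_shift_ge0 s g (g i); rewrite -/S -/Q => cross.
set C := 4 ^+ size s in IH *.
have C1 : 1 <= C by apply: exprn_ege1; lra.
have Cn : (size s)%:R <= C.
  by rewrite /C -natrX ler_nat ltnW // ltn_expl.
set P := \prod_(j <- s) _ in IH *.
have step : (1 + g i) * (1 + S - C * Q) <= (1 + g i) * P.
  by apply: ler_wpM2l => //; lra.
apply: le_trans step.
have G0 : 0 <= g i ^+ 2 by exact: sqr_ge0.
have H1 : (size s)%:R * g i ^+ 2 <= C * g i ^+ 2 by apply: ler_wpM2r.
have H0 : 0 <= C * g i ^+ 2 by apply: mulr_ge0 => //; lra.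
have H2 : Q <= C * Q by apply: ler_peMl.
have H3 : g i * (C * Q) <= C * Q by apply: ler_piMl => //; lra.
lra.
Qed.

End ProductBound.

(** * The penalty function *)

Section CappedDeviation.
Set Implicit Arguments.
Unset Strict Implicit.
Context (R : realType).
Implicit Types p q x C : R.

(** The cap at p keeps the relative deviation bounded even though W / q may be
    as large as 1 / q; capping decreases both the density and the entropy. *)
Definition capped_dev p q x : R := Num.min x p / q - 1.

(** The constant 1 makes the function nonnegative, so that Tonelli applies to
    its integrals. *)
Definition penalty C p q x : R :=
  1 - capped_dev p q x + C * capped_dev p q x ^+ 2.

Lemma capped_dev_bound p q x : 0 < q -> q <= p -> p <= 2 * q -> 0 <= x ->
  -1 <= capped_dev p q x <= 1.
Proof.
move=> q0 qp p2q x0.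
have m0 : 0 <= Num.min x p by rewrite le_min x0 (le_trans (ltW q0)).
have mp : Num.min x p <= p by rewrite ge_min lexx orbT.
have : 0 <= Num.min x p / q by rewrite divr_ge0 // ltW.
have : Num.min x p / q <= 2 by rewrite ler_pdivrMr //; lra.
rewrite /capped_dev; lra.
Qed.

Lemma penalty_ge0 C p q x : 0 < q -> q <= p -> p <= 2 * q -> 0 <= x -> 0 <= C ->
  0 <= penalty C p q x.
Proof.
move=> q0 qp p2q x0 C0; have := capped_dev_bound q0 qp p2q x0.
have : 0 <= C * capped_dev p q x ^+ 2 by rewrite mulr_ge0 // sqr_ge0.
rewrite /penalty; lra.
Qed.

Lemma penalty_le C p q x : 0 < q -> q <= p -> p <= 2 * q -> 0 <= x -> 0 <= C ->
  penalty C p q x <= 2 + C.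
Proof.
move=> q0 qp p2q x0 C0; have /andP[] := capped_dev_bound q0 qp p2q x0.
move=> l u.
have : C * capped_dev p q x ^+ 2 <= C.
  by apply: ler_piMr => //; rewrite -real_normK ?num_real // exprn_ile1 // ler_norml l.
rewrite /penalty; lra.
Qed.

Lemma prod_ge_penalty p q (I : Type) (s : seq I) (w : I -> R) :
  0 < q -> q <= p -> p <= 2 * q -> (forall i, 0 <= w i) ->
  q ^+ size s * (1 + (size s)%:R)
    <= \prod_(i <- s) w i
       + q ^+ size s * \sum_(i <- s) penalty (4 ^+ size s) p q (w i).
Proof.
move=> q0 qp p2q w0.
have main := prod1D_ge_quadratic (g := capped_dev p q \o w) s
  (fun i => capped_dev_bound q0 qp p2q (w0 i)).
have prodle : q ^+ size s * \prod_(i <- s) (1 + capped_dev p q (w i))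
              <= \prod_(i <- s) w i.
  have -> : q ^+ size s = \prod_(i <- s) q by rewrite big_const_seq count_predT iter_mulr_1.
  rewrite -big_split /=; apply: ler_prod => i _.
  rewrite /capped_dev.
  have -> : q * (1 + (Num.min (w i) p / q - 1)) = Num.min (w i) p.
    by field; exact: lt0r_neq0.
  by rewrite ge_min lexx le_min w0 (le_trans (ltW q0)).
have -> : \sum_(i <- s) penalty (4 ^+ size s) p q (w i) =
    (size s)%:R - \sum_(i <- s) capped_dev p q (w i)
    + 4 ^+ size s * \sum_(i <- s) capped_dev p q (w i) ^+ 2.
  rewrite big_split /= -mulr_sumr big_split /= sumrN; congr (_ - _ + _).
  by rewrite big_const_seq count_predT iter_addr_0.
have qn0 : 0 <= q ^+ size s by rewrite exprn_ge0 // ltW.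
have := ler_wpM2l qn0 main; rewrite /=.
lra.
Qed.

End CappedDeviation.

(** * Relative entropy and the gap function *)

Section RelativeEntropy.
Set Implicit Arguments.
Unset Strict Implicit.
Context (R : realType).
Implicit Types p q x C : R.

Lemma mulr_ln_div x p : 0 <= x -> 0 < p -> x * ln (x / p) = x * ln x - x * ln p.
Proof.
rewrite le_eqVlt => /predU1P[<-|x0] p0; first by rewrite !mul0r subrr.
by rewrite ln_div ?posrE // mulrBr.
Qed.

(** The inequality ln y <= y - 1 at y = sqrt (p / x).  It replaces a Taylor
    expansion of x ln x and is also valid at x = 0. *)
Lemma mulr_ln_div_ge x p : 0 <= x -> 0 < p ->
  (Num.sqrt x - Num.sqrt p) ^+ 2 + x - p <= x * ln (x / p).
Proof.
rewrite le_eqVlt => /predU1P[<-|x0] p0.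
  rewrite sqrtr0 !mul0r sub0r sqrrN sqr_sqrtr ?(ltW p0) //; lra.
have sx : 0 < Num.sqrt x by rewrite sqrtr_gt0.
have sp : 0 < Num.sqrt p by rewrite sqrtr_gt0.
have : ln (Num.sqrt p / Num.sqrt x) <= Num.sqrt p / Num.sqrt x - 1.
  have -> : Num.sqrt p / Num.sqrt x = 1 + (Num.sqrt p / Num.sqrt x - 1) by ring.
  rewrite [X in _ <= X](_ : _ = Num.sqrt p / Num.sqrt x - 1); last by ring.
  apply: le_ln1Dx.
  by have : 0 < Num.sqrt p / Num.sqrt x by [exact: divr_gt0]; lra.
have eqx : Num.sqrt x * Num.sqrt x = x by rewrite -expr2 sqr_sqrtr // ltW.
have eqp : Num.sqrt p * Num.sqrt p = p by rewrite -expr2 sqr_sqrtr // ltW.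
rewrite [ln (_ / Num.sqrt x)]ln_div ?posrE //.
have -> : ln (x / p) = 2 * (ln (Num.sqrt x) - ln (Num.sqrt p)).
  by rewrite -{1}eqx -{1}eqp ln_div ?posrE ?mulr_gt0 // !lnM ?posrE //; ring.
move=> H; have := ler_wpM2l (ltW x0) H.
have -> : x * (Num.sqrt p / Num.sqrt x - 1) = Num.sqrt x * Num.sqrt p - x.
  rewrite mulrBr mulr1; congr (_ - _).
  by rewrite -[X in X * (_ / _)]eqx; field; exact: lt0r_neq0.
rewrite sqrrB !expr2 eqx eqp; lra.
Qed.

Lemma Ip_ge_sqrt p x : 0 < p < 1 -> 0 <= x <= 1 ->
  (Num.sqrt x - Num.sqrt p) ^+ 2 <= Ip p x.
Proof.
move=> /andP[p0 p1] /andP[x0 x1]; rewrite /Ip.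
have h1 := mulr_ln_div_ge x0 p0.
have h2 : (Num.sqrt (1 - x) - Num.sqrt (1 - p)) ^+ 2 + (1 - x) - (1 - p)
    <= (1 - x) * ln ((1 - x) / (1 - p)) by apply: mulr_ln_div_ge; lra.
have := sqr_ge0 (Num.sqrt (1 - x) - Num.sqrt (1 - p)).
lra.
Qed.

Lemma Ip_ge0 p x : 0 < p < 1 -> 0 <= x <= 1 -> 0 <= Ip p x.
Proof.
by move=> hp hx; apply: le_trans (Ip_ge_sqrt hp hx); exact: sqr_ge0.
Qed.

Lemma Ip_gt0 p x : 0 < p < 1 -> 0 <= x <= 1 -> x != p -> 0 < Ip p x.
Proof.
move=> hp hx xp; apply: lt_le_trans (Ip_ge_sqrt hp hx).
rewrite lt0r sqr_ge0 andbT sqrf_eq0 subr_eq0.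
by rewrite eqr_sqrt //; case/andP: hp; case/andP: hx => // *; exact: ltW.
Qed.

Lemma Ippp p : 0 < p < 1 -> Ip p p = 0.
Proof.
move=> /andP[p0 p1]; rewrite /Ip !divff ?ln1 ?mulr0 ?addr0 //; last exact: lt0r_neq0.
by rewrite lt0r_neq0 // subr_gt0.
Qed.

Lemma Ip_le p x : 0 < p < 1 -> 0 <= x <= 1 -> Ip p x <= p^-1 + (1 - p)^-1.
Proof.
have main a y : 0 < a -> 0 <= y <= 1 -> y * ln (y / a) <= a^-1.
  move=> a0 /andP[]; rewrite le_eqVlt => /predU1P[<- _|y0 y1].
    by rewrite mul0r invr_ge0 ltW.
  have ya : 0 < y / a by exact: divr_gt0.
  apply: (@le_trans _ _ (y * (y / a))).
    by rewrite ler_wpM2l // ltW // ln_sublinear.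
  rewrite mulrA; apply: ler_piMl; first by rewrite invr_ge0 ltW.
  by apply: mulr_ile1 => //; exact: ltW.
move=> /andP[p0 p1] /andP[x0 x1]; apply: lerD; apply: main; lra.
Qed.

(** Minus the derivative of I_p at q. *)
Definition neg_slope p q : R := ln (p / q) + ln ((1 - q) / (1 - p)).

(** I_p differs from the entropy x ln x + (1 - x) ln (1 - x) by an affine
    function, so its remainder after the tangent line at q is independent of p:
    it is I_q. *)
Lemma Ip_bregman p q x : 0 < p < 1 -> 0 < q < 1 -> 0 <= x <= 1 ->
  Ip p x - Ip p q + neg_slope p q * (x - q) = Ip q x.
Proof.
move=> /andP[p0 p1] /andP[q0 q1] /andP[x0 x1]; rewrite /Ip /neg_slope.
rewrite !mulr_ln_div ?subr_gt0 ?subr_ge0 //; try exact: ltW.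
rewrite !ln_div ?posrE ?subr_gt0 //; ring.
Qed.

(** Here (sqrt x - sqrt q)^2 = (x - q)^2 / (sqrt x + sqrt q)^2, and the
    denominator is at most 4 p. *)
Lemma Ip_ge_sqr p q x : 0 < q <= p -> p < 1 -> 0 <= x <= p ->
  (x - q) ^+ 2 / (4 * p) <= Ip q x.
Proof.
move=> /andP[q0 qp] p1 /andP[x0 xp]; have p0 : 0 < p by lra.
have hq : 0 < q < 1 by lra.
have hx : 0 <= x <= 1 by lra.
apply: le_trans (Ip_ge_sqrt hq hx).
rewrite ler_pdivrMr; last by lra.
have eqx : Num.sqrt x ^+ 2 = x by rewrite sqr_sqrtr.
have eqq : Num.sqrt q ^+ 2 = q by rewrite sqr_sqrtr // ltW.
rewrite -{1}eqx -{1}eqq subr_sqr exprMn.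
apply: ler_wpM2l; first exact: sqr_ge0.
have := sqr_ge0 (Num.sqrt x - Num.sqrt q).
rewrite sqrrB sqrrD eqx eqq; lra.
Qed.

Lemma neg_slope_ge0 p q : 0 < q <= p -> p < 1 -> 0 <= neg_slope p q.
Proof.
move=> /andP[q0 qp] p1; apply: addr_ge0; apply: ln_ge0.
  by rewrite ler_pdivlMr // mul1r.
by rewrite ler_pdivlMr; lra.
Qed.

Lemma neg_slope_le p q : 0 < q <= p -> p <= 2^-1 -> neg_slope p q * q <= 2 * (p - q).
Proof.
move=> /andP[q0 qp] p2.
have h1 : ln (p / q) <= (p - q) / q.
  have -> : p / q = 1 + (p - q) / q by field; exact: lt0r_neq0.
  by apply: le_ln1Dx; have : 0 <= (p - q) / q by [rewrite divr_ge0; lra]; lra.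
have h2 : ln ((1 - q) / (1 - p)) <= (p - q) / q.
  have e : (1 - q) / (1 - p) = 1 + (p - q) / (1 - p) by field; lra.
  have d0 : 0 <= (p - q) / (1 - p) by rewrite divr_ge0; lra.
  apply: (@le_trans _ _ ((p - q) / (1 - p))); first by rewrite e le_ln1Dx //; lra.
  by rewrite ler_wpM2l ?lef_pV2 ?posrE; lra.
have -> : 2 * (p - q) = ((p - q) / q + (p - q) / q) * q.
  by field; exact: lt0r_neq0.
by rewrite ler_pM2r // lerD.
Qed.

(** What remains of the entropy cost after subtracting its value at q and the
    multiple of the penalty that cancels the linear term at q. *)
Definition gap C p q x : R :=
  Ip p x - Ip p q - q * neg_slope p q * (penalty C p q x - 1).

(** Below the cap the linear terms cancel, leaving I_q(x), at least
    (x - q)^2 / (4 p), minus s * C * (x - q)^2 / q with s the absolute slope at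
    q.  The hypothesis on p - q makes s * C at most q / (16 p), so that the
    second term uses up at most a quarter of the first. *)
Lemma gap_ge_sqr C p q x : 0 < q <= p -> p <= 2^-1 -> 1 <= C ->
  64 * C * (p - q) <= q -> 0 <= x <= p -> (x - q) ^+ 2 / (8 * p) <= gap C p q x.
Proof.
move=> /andP[q0 qp] p2 C1 pq /andP[x0 xp].
have p0 : 0 < p by lra.
have p2q : p <= 2 * q.
  have : p - q <= C * (p - q) by apply: ler_peMl => //; lra.
  lra.
have hqp : 0 < q <= p by rewrite q0.
have s0 : 0 <= neg_slope p q by apply: neg_slope_ge0 => //; lra.
have sl := neg_slope_le hqp p2.
have I1 : (x - q) ^+ 2 / (4 * p) <= Ip q x by apply: Ip_ge_sqr => //; lra.
have br : Ip p x - Ip p q + neg_slope p q * (x - q) = Ip q x.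
  by apply: Ip_bregman; lra.
have -> : gap C p q x = Ip q x - neg_slope p q * C * ((x - q) ^+ 2 / q).
  rewrite -br /gap /penalty /capped_dev (min_idPl xp).
  by field; exact: lt0r_neq0.
set D := (x - q) ^+ 2 in I1 *.
have D0 : 0 <= D by exact: sqr_ge0.
have sC : neg_slope p q * C * (16 * p) <= q.
  have : neg_slope p q * C * (16 * p) <= neg_slope p q * C * (16 * (2 * q)).
    apply: ler_wpM2l; first by apply: mulr_ge0 => //; lra.
    lra.
  have := ler_wpM2l (_ : 0 <= 32 * C) sl; lra.
have : neg_slope p q * C * (D / q) <= D / (16 * p).
  rewrite mulrA ler_pdivrMr // [leRHS]mulrAC ler_pdivlMr; last by lra.
  have := ler_wpM2l D0 sC; lra.
have -> : D / (16 * p) = (D / p) / 16 by field; exact: lt0r_neq0.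
have e4 : D / (4 * p) = (D / p) / 4 by field; exact: lt0r_neq0.
have -> : D / (8 * p) = (D / p) / 8 by field; exact: lt0r_neq0.
have : 0 <= D / p by rewrite divr_ge0 // ltW.
rewrite e4 in I1; lra.
Qed.

(** Above p the penalty is constant, and I_p vanishes at p. *)
Lemma gap_above_cap C p q x : 0 < p < 1 -> p <= x ->
  gap C p q x = Ip p x + gap C p q p.
Proof.
move=> hp px; rewrite /gap (Ippp hp) /penalty /capped_dev (min_idPr px).
by rewrite minxx; ring.
Qed.

Lemma gap_gt0 C p q x : 0 < q <= p -> p <= 2^-1 -> 1 <= C ->
  64 * C * (p - q) <= q -> 0 <= x <= 1 -> x != q -> 0 < gap C p q x.
Proof.
move=> hq p2 C1 pq /andP[x0 x1] xq; have /andP[q0 qp] := hq.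
have p0 : 0 < p by lra.
have [xp|px] := leP x p.
  have h : (x - q) ^+ 2 / (8 * p) <= gap C p q x.
    by apply: gap_ge_sqr => //; rewrite x0.
  apply: lt_le_trans h; rewrite divr_gt0 //; last by lra.
  by rewrite lt0r sqr_ge0 andbT sqrf_eq0 subr_eq0.
rewrite gap_above_cap; [|lra|exact: ltW].
apply: ltr_pwDl; first by apply: Ip_gt0; [lra|lra|rewrite gt_eqF].
have h : (p - q) ^+ 2 / (8 * p) <= gap C p q p.
  by apply: gap_ge_sqr => //; lra.
by apply: le_trans h; rewrite divr_ge0 ?sqr_ge0 //; lra.
Qed.

Lemma gapqq C p q : 0 < q <= p -> gap C p q q = 0.
Proof.
move=> /andP[q0 qp]; rewrite /gap /penalty /capped_dev (min_idPl qp) divff ?lt0r_neq0 //.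
ring.
Qed.

Lemma gap_ge0 C p q x : 0 < q <= p -> p <= 2^-1 -> 1 <= C ->
  64 * C * (p - q) <= q -> 0 <= x <= 1 -> 0 <= gap C p q x.
Proof.
move=> hq p2 C1 pq hx; have [->|xq] := eqVneq x q; first by rewrite gapqq.
by apply: ltW; exact: gap_gt0.
Qed.

(** With L = - ln (1 - p) = I_p(0) >= p, the bounds on y ln y give
    I_p(q) >= (1 - q) L + q - 2 sqrt (p q), and both q L and 2 sqrt (p q) are
    small multiples of L when q < p / 100. *)
Lemma Ip_near0_gt p q : 0 < p < 1 -> 0 <= q < p / 100 ->
  Ip p 0 < 2 * Ip p q.
Proof.
move=> /andP[p0 p1] /andP[q0 qp].
set L := - ln (1 - p).
have Lp : p <= L.
  by have := @le_ln1Dx _ (- p) _; rewrite /L; lra.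
have -> : Ip p 0 = L.
  by rewrite /Ip mul0r add0r subr0 mul1r div1r lnV ?posrE ?subr_gt0.
have h1 := mulr_ln_div_ge q0 p0.
have h2 : (Num.sqrt (1 - q) - Num.sqrt 1) ^+ 2 + (1 - q) - 1
    <= (1 - q) * ln ((1 - q) / 1) by apply: mulr_ln_div_ge; lra.
have h3 := sqr_ge0 (Num.sqrt (1 - q) - Num.sqrt 1).
have h4 : Num.sqrt q * Num.sqrt p <= p / 10.
  rewrite -(@ler_pXn2r _ 2) ?nnegrE ?mulr_ge0 ?sqrtr_ge0 ?invr_ge0 ?(ltW p0) //.
  rewrite !exprMn !sqr_sqrtr //; last exact: ltW.
  have := ler_wpM2r (ltW p0) (ltW qp); lra.
have h5 : 0 <= (100^-1 - q) * L by apply: mulr_ge0; lra.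
have eqq : Num.sqrt q ^+ 2 = q by rewrite sqr_sqrtr.
have eqp : Num.sqrt p ^+ 2 = p by rewrite sqr_sqrtr // ltW.
rewrite sqrrB eqq eqp in h1.
rewrite /Ip [X in _ + X]mulr_ln_div ?subr_gt0 ?subr_ge0 //; last by lra.
rewrite divr1 in h2.
rewrite -/L.
have -> : ln (1 - p) = - L by rewrite /L opprK.
lra.
Qed.

End RelativeEntropy.

(** * Marginals of product measures on tuples *)

Section TupleMarginals.
Set Implicit Arguments.
Unset Strict Implicit.
Local Open Scope ereal_scope.
Context d (T : measurableType d) (R : realType) (P : probability T R).

Lemma integral_probability_cst d' (T' : measurableType d')
    (Q : probability T' R) (f : T' -> \bar R) (c : \bar R) :
  (forall x, f x = c) -> \int[Q]_x f x = c.
Proof.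
move=> fc; under eq_integral do rewrite fc.
rewrite (integral_cst Q measurableT c).
by rewrite [X in c * X](_ : _ = 1) ?mule1 //; exact: probability_setT.
Qed.

Lemma integral_tuple_prob_cons n (f : n.+1.-tuple T -> \bar R) :
  measurable_fun [set: n.+1.-tuple T] f -> (forall t, 0 <= f t) ->
  \int[tuple_prob P n.+1]_t f t
    = \int[P]_x \int[tuple_prob P n]_t f (cons_pair (x, t)).
Proof.
move=> mf f0.
rewrite /= ge0_integral_distribution // fubini_tonelli1 //=.
exact: measurableT_comp.
Qed.

Lemma integral_tuple_prob_coord n (i : 'I_n) (f : T -> \bar R) :
  measurable_fun setT f -> (forall x, 0 <= f x) ->
  \int[tuple_prob P n]_t f (tnth t i) = \int[P]_x f x.
Proof.
move=> mf f0; elim: n i => [[]//|n IH] i.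
rewrite integral_tuple_prob_cons //; last first.
  by apply: measurableT_comp => //; exact: measurable_tnth.
have [j ->|->] := unliftP ord0 i.
  apply: integral_probability_cst => x.
  by under eq_integral do rewrite tnthS /=; exact: IH.
by apply: eq_integral => x _; exact: integral_probability_cst.
Qed.

(** Induction on [n], splitting off coordinate 0: if i is that coordinate,
    Tonelli reduces the claim to the one-coordinate marginal; otherwise the
    integrand does not depend on it. *)
Lemma integral_tuple_prob_pair n (i j : 'I_n) (f : T * T -> \bar R) :
  (i < j)%N -> measurable_fun setT f -> (forall z, 0 <= f z) ->
  \int[tuple_prob P n]_t f (tnth t i, tnth t j) = \int[P \x P]_z f z.
Proof.
move=> ij mf f0; elim: n i j ij => [[]//|n IH] i j ij.
rewrite integral_tuple_prob_cons //; last first.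
  apply: measurableT_comp => //; apply: measurable_fun_pair;
  exact: measurable_tnth.
have [j' ej|ej] := unliftP ord0 j; last by rewrite ej in ij.
have [i' ei|ei] := unliftP ord0 i; subst i j.
  apply: integral_probability_cst => x.
  by under eq_integral do rewrite !tnthS /=; exact: IH.
rewrite fubini_tonelli1 //; apply: eq_integral => x _.
under eq_integral do rewrite tnthS tnth0 /=.
apply: (@integral_tuple_prob_coord n j' (fun y => f (x, y))) => //.
exact: measurableT_comp.
Qed.

Lemma tuple_prob_cube n (A : set T) : measurable A -> P A = 1 ->
  measurable [set t : n.-tuple T | forall i, A (tnth t i)] /\
  tuple_prob P n [set t : n.-tuple T | forall i, A (tnth t i)] = 1.
Proof.
move=> mA PA.
have mC k : measurable [set t : k.-tuple T | forall i, A (tnth t i)].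
  rewrite (_ : [set _ | _] =
      \bigcap_(i in [set: 'I_k]) ((fun t => tnth t i) @^-1` A)); last first.
    by apply/seteqP; split => t /= h i; [move=> _; exact: h|exact: (h i)].
  apply: fin_bigcap_measurable; first exact: finite_finset.
  by move=> i _; rewrite -[X in measurable X]setTI; exact: measurable_tnth.
split; first exact: mC.
elim: n => [|n IH].
  rewrite /= diracE mem_set //=; first by case.
rewrite /= /distribution /pushforward /=.
rewrite (_ : _ @^-1` _ =
    A `*` [set t : n.-tuple T | forall i, A (tnth t i)]); last first.
  apply/seteqP; split => -[x t] /=.
    move=> h; split => [|i]; first by have := h ord0; rewrite tnth0.
    by have := h (lift ord0 i); rewrite tnthS.
  move=> [Ax At] i; have [j ->|->] := unliftP ord0 i; rewrite ?tnthS ?tnth0 //.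
rewrite (product_measure1E _ _ mA (mC n)) -[RHS]mule1.
by congr (_ * _); [exact: PA|exact: IH].
Qed.

End TupleMarginals.

(** * Integrals over graphons *)

Section GraphonIntegrals.
Set Implicit Arguments.
Unset Strict Implicit.
Context (R : realType).
Implicit Types (W : R * R -> R) (f : R -> R) (p q C : R).

Lemma bounded_integrable d (T : measurableType d) (P : probability T R)
    (D : set T) (f : T -> R) (M : R) :
  measurable D -> measurable_fun D f -> (forall x, D x -> 0 <= f x <= M) ->
  P.-integrable D (EFin \o f).
Proof.
move=> mD mf fM; apply: measurable_bounded_integrable => //.
  by apply: le_lt_trans (probability_le1 P mD) _; rewrite ltry.
exists M; split; first exact: num_real.
move=> x Mx y Dy; have /andP[f0 fm] := fM y Dy.
by rewrite /= ger0_norm // (le_trans fm) // ltW.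
Qed.

Lemma measurable_Ip p : measurable_fun [set: R] (Ip p).
Proof.
have mln a : measurable_fun [set: R] (fun x : R => ln (x / a)).
  apply: measurableT_comp; first exact: measurable_ln.
  exact: measurable_funM.
apply: measurable_funD; apply: measurable_funM => //.
  exact: measurable_funB.
have mB : measurable_fun [set: R] (fun x : R => 1 - x) by exact: measurable_funB.
exact: (measurableT_comp (mln (1 - p)) mB).
Qed.

Lemma measurable_penalty C p q : measurable_fun [set: R] (penalty C p q).
Proof.
have mdev : measurable_fun [set: R] (capped_dev p q).
  apply: measurable_funB => //; apply: measurable_funM => //.
  exact: measurable_minr.
apply: measurable_funD; first exact: measurable_funB.
by apply: measurable_funM => //; exact: measurable_funX.
Qed.

Lemma measurable_gap C p q : measurable_fun [set: R] (gap C p q).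
Proof.
apply: measurable_funB; first by apply: measurable_funB => //; exact: measurable_Ip.
apply: measurable_funM => //; apply: measurable_funB => //.
exact: measurable_penalty.
Qed.

Lemma measurable_I01 : measurable (@I01 R : set (measurableTypeR R)).
Proof. exact: measurable_itv. Qed.

Lemma measurable_sq01 :
  measurable (@sq01 R : set (measurableTypeR R * measurableTypeR R)).
Proof. by apply: measurableX; exact: measurable_I01. Qed.

Lemma mu01E (A : set R) : measurable A -> A `<=` @I01 R ->
  mu01 R A = lebesgue_measure A.
Proof.
move=> mA AI; rewrite /mu01 /= /uniform_prob.
rewrite (eq_integral (fun=> 1%E)); last first.
  move=> x; rewrite inE => /AI; rewrite /I01 /= in_itv /= => h.
  by rewrite /uniform_pdf h subr0 invr1.
by rewrite integral_cst // mul1e.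
Qed.

Lemma mu01_I01 : mu01 R (@I01 R) = 1%E.
Proof.
rewrite mu01E //; last exact: measurable_I01.
by rewrite /I01 lebesgue_measure_itv /= lte_fin ltr01 oppr0 adde0.
Qed.

Lemma mu01sq_sq01 : mu01sq R (@sq01 R) = 1%E.
Proof.
transitivity (mu01 R (@I01 R) * mu01 R (@I01 R))%E.
  by apply: product_measure1E; exact: measurable_I01.
by rewrite mu01_I01 mule1.
Qed.

Lemma graphon_cst q : 0 <= q <= 1 -> is_graphon (cst q : R * R -> R).
Proof. by move=> q01; split. Qed.

Lemma mean_cst f q : mean f (cst q) = f q.
Proof.
rewrite /mean (Rintegral_cst (mu01sq R) measurable_sq01 (f q)).
by rewrite [X in _ * X](_ : _ = 1) ?mulr1 //; exact: (congr1 fine mu01sq_sq01).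
Qed.

Lemma mean_integrable W f M : is_graphon W -> measurable_fun setT f ->
  (forall x, 0 <= x <= 1 -> 0 <= f x <= M) ->
  (mu01sq R).-integrable (@sq01 R) (EFin \o (f \o W)).
Proof.
move=> [mW W01 _] mf fM; apply: (@bounded_integrable _ _ _ _ _ M).
- exact: measurable_sq01.
- exact: measurableT_comp.
- by move=> -[x y] [/= Ix Iy]; apply: fM; exact: W01.
Qed.

End GraphonIntegrals.

(** * Homomorphism densities *)

Section HomDensity.
Set Implicit Arguments.
Unset Strict Implicit.
Context (R : realType) (V : finType) (E : rel V).
Implicit Types (W : R * R -> R) (f : R -> R) (p q : R).

Local Notation cube := (@cube01 R V).
Local Notation P := (tuple_prob (mu01 R) #|V|).

Lemma cube01E : cube =
  [set t : #|V|.-tuple (measurableTypeR R) | forall i, I01 (tnth t i)].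
Proof.
apply/seteqP; split => t h i; last exact: h.
by have := h (enum_val i); rewrite /vertex_coord enum_valK.
Qed.

Let tuple_prob_I01 := @tuple_prob_cube _ (measurableTypeR R) R (mu01 R) #|V|
  (@I01 R) (@measurable_I01 R) (mu01_I01 R).

Lemma measurable_cube01 : measurable (cube : set (#|V|.-tuple (measurableTypeR R))).
Proof. by rewrite cube01E; apply: (tuple_prob_I01).1. Qed.

Lemma tuple_prob_cube01 : P cube = 1%E.
Proof. by rewrite cube01E; apply: (tuple_prob_I01).2. Qed.

Lemma measurable_graphon_edge W (i j : V) : is_graphon W ->
  measurable_fun (cube : set (#|V|.-tuple (measurableTypeR R)))
    (fun x => W (vertex_coord x i, vertex_coord x j)).
Proof.
move=> [mW _ _].
apply: (measurable_comp (@measurable_sq01 R) _ mW).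
  by move=> _ [x h <-]; split; exact: h.
apply: measurable_funTS; apply: measurable_fun_pair; exact: measurable_tnth.
Qed.

Lemma graphon_edge_bound W (x : #|V|.-tuple R) (e : V * V) :
  is_graphon W -> cube x ->
  0 <= W (vertex_coord x e.1, vertex_coord x e.2) <= 1.
Proof. by move=> [_ W01 _] h; apply: W01; exact: h. Qed.

Lemma hom_density_integrable W : is_graphon W ->
  P.-integrable cube (EFin \o (fun x : #|V|.-tuple R =>
    \prod_(ij in edges E) W (vertex_coord x ij.1, vertex_coord x ij.2))).
Proof.
move=> gW; apply: (@bounded_integrable _ _ _ _ _ _ 1).
- exact: measurable_cube01.
- under eq_fun do rewrite -big_enum.
  apply: measurable_prod => e _; exact: measurable_graphon_edge.
- move=> x h; have b e := graphon_edge_bound e gW h.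
  apply/andP; split; last by apply: prodr_ile1 => e _; exact: b.
  by apply: prodr_ge0 => e _; case/andP: (b e).
Qed.

(** Extending f o W by 0 outside the unit square turns the left-hand side into
    an integral over part of the tuple space, and the pair marginal then
    identifies the full integral with the mean. *)
Lemma edge_integral_le W f (M : R) (i j : V) : is_graphon W ->
  measurable_fun setT f -> (forall x, 0 <= x <= 1 -> 0 <= f x <= M) ->
  (enum_rank i < enum_rank j)%N ->
  (\int[P]_(x in cube) (f (W (vertex_coord x i, vertex_coord x j)))%:E
     <= (mean f W)%:E)%E.
Proof.
move=> gW mf fM ij; have [mW W01 _] := gW.
have fW := mean_integrable gW mf fM.
have mfW := measurable_int _ fW.
have fW0 z : sq01 z -> (0 <= ((EFin \o (f \o W)) z))%E.
  by case: z => x y [/= Ix Iy]; rewrite lee_fin; case/andP: (fM _ (W01 _ _ Ix Iy)).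
pose F : R * R -> \bar R := (EFin \o (f \o W)) \_ (@sq01 R).
have mF : measurable_fun setT F.
  by apply/(measurable_restrictT _ (@measurable_sq01 R)).
have F0 z : (0 <= F z)%E.
  by rewrite /F patchE; case: ifPn => // /set_mem; exact: fW0.
have -> : (mean f W)%:E = (\int[mu01sq R]_z F z)%E.
  rewrite -integral_mkcond /mean /Rintegral fineK //.
  by apply: integrable_fin_num fW; exact: measurable_sq01.
rewrite -(integral_tuple_prob_pair (mu01 R) ij mF F0).
apply: (@le_trans _ _
  (\int[P]_(t in cube) F (tnth t (enum_rank i), tnth t (enum_rank j)))%E).
  rewrite le_eqVlt; apply/orP; left; apply/eqP; apply: eq_integral.
  by move=> t /set_mem h; rewrite /F patchE mem_set //; split; exact: h.
apply: ge0_subset_integral => //; first exact: measurable_cube01.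
apply: measurableT_comp => //; apply: measurable_fun_pair;
exact: measurable_tnth.
Qed.

End HomDensity.

(** * The constant graphon is optimal for q near p *)

Section NearP.
Set Implicit Arguments.
Unset Strict Implicit.
Context (R : realType) (V : finType) (E : rel V).
Implicit Types (W : R * R -> R) (f : R -> R) (p q : R).

Local Notation cube := (@cube01 R V).
Local Notation P := (tuple_prob (mu01 R) #|V|).
Local Notation n := #|edges E|.
Local Notation C := (4 ^+ n : R).

(** Integrating [prod_ge_penalty] over the cube gives
    q^n (1 + n) <= t(H, W) + q^n n E[h(W)], where t(H, W) <= q^n. *)
Lemma mean_penalty_ge1 p q W : (0 < n)%N -> 0 < q <= p -> p <= 2 * q ->
  LT_feasible E q W -> 1 <= mean (penalty C p q) W.
Proof.
move=> n0 /andP[q0 qp] p2q [gW tW].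
set h := penalty C p q.
have C0 : 0 <= C by rewrite exprn_ge0.
have qn0 : 0 < q ^+ n by rewrite exprn_gt0.
have hb x : 0 <= x <= 1 -> 0 <= h x <= 2 + C.
  by move=> /andP[x0 _]; rewrite /h penalty_ge0 ?penalty_le.
have mh : measurable_fun setT h by exact: measurable_penalty.
pose w (x : #|V|.-tuple (measurableTypeR R)) (e : V * V) :=
  W (vertex_coord x e.1, vertex_coord x e.2).
have mw e : measurable_fun cube (fun x => w x e).
  exact: measurable_graphon_edge.
have intT := hom_density_integrable E gW.
have eqT : (hom_density E W)%:E =
    (\int[P]_(x in cube) (\prod_(e in edges E) w x e)%:E)%E.
  rewrite /hom_density /Rintegral fineK //.
  by apply: integrable_fin_num intT; exact: measurable_cube01.
have main : ((q ^+ n * (1 + n%:R))%:E <=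
    (hom_density E W)%:E
    + \sum_(e <- enum (edges E))
        \int[P]_(x in cube) (q ^+ n * h (w x e))%:E)%E.
  rewrite eqT.
  rewrite -ge0_integral_sum; last 3 first.
  - exact: measurable_cube01.
  - move=> e; apply/measurable_EFinP; apply: measurable_funM => //.
    exact: (measurableT_comp mh (mw e)).
  - move=> e x hx; rewrite lee_fin mulr_ge0 ?(ltW qn0) //.
    by case/andP: (hb _ (graphon_edge_bound e gW hx)).
  rewrite -ge0_integralD; last 5 first.
  - exact: measurable_cube01.
  - move=> x hx; rewrite lee_fin prodr_ge0 // => e _.
    by case/andP: (graphon_edge_bound e gW hx).
  - exact: measurable_int intT.
  - move=> x hx; apply: sume_ge0 => e _; rewrite lee_fin mulr_ge0 ?(ltW qn0) //.
    by case/andP: (hb _ (graphon_edge_bound e gW hx)).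
  - apply: emeasurable_sum => e; apply/measurable_EFinP.
    by apply: measurable_funM => //; exact: (measurableT_comp mh (mw e)).
  have -> : (q ^+ n * (1 + n%:R))%:E =
      (\int[P]_(x in cube) (cst (q ^+ n * (1 + n%:R))%:E) x)%E.
    rewrite integral_cst; last exact: measurable_cube01.
    by rewrite [X in (_ * X)%E](_ : _ = 1%E) ?mule1 //; exact: tuple_prob_cube01.
  apply: ge0_le_integral.
  - exact: measurable_cube01.
  - by move=> x _; rewrite lee_fin mulr_ge0 ?(ltW qn0) // addr_ge0.
  - exact: measurable_cst.
  - apply: emeasurable_funD; first exact: measurable_int intT.
    apply: emeasurable_sum => e; apply/measurable_EFinP.
    by apply: measurable_funM => //; exact: (measurableT_comp mh (mw e)).
  - move=> x hx; rewrite sumEFin -EFinD lee_fin /= -mulr_sumr -big_enum /= cardE.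
    rewrite /h cardE.
    apply: prod_ge_penalty => // e.
    by case/andP: (graphon_edge_bound e gW hx).
have bound : (\sum_(e <- enum (edges E))
    \int[P]_(x in cube) (q ^+ n * h (w x e))%:E
      <= \sum_(e <- enum (edges E)) (q ^+ n * mean h W)%:E)%E.
  rewrite big_seq [leRHS]big_seq; apply: lee_sum => e.
  rewrite mem_enum inE => /andP[_ he].
  have -> : q ^+ n * mean h W = mean (fun x => q ^+ n * h x) W.
    rewrite /mean RintegralZl //; first exact: measurable_sq01.
    exact: mean_integrable hb.
  apply: (@edge_integral_le _ _ W (fun x => q ^+ n * h x) (q ^+ n * (2 + C))) => //.
    exact: measurable_funM.
  move=> x /hb /andP[h0 h1]; rewrite mulr_ge0 ?(ltW qn0) //=.
  by rewrite ler_wpM2l ?(ltW qn0).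
have := le_trans main (leeD2l _ bound).
rewrite sumEFin -EFinD lee_fin big_const_seq count_predT iter_addr_0 -cardE => le1.
have {le1 tW} : q ^+ n * (1 + n%:R) <= q ^+ n * (1 + n%:R * mean h W).
  apply: le_trans le1 _; rewrite mulrDr mulr1 lerD // -mulr_natl; lra.
rewrite ler_pM2l // lerD2l -[X in X <= _]mulr1 ler_pM2l // ltr0n //.
Qed.

Lemma hom_density_cst q : hom_density E (cst q) = q ^+ n.
Proof.
rewrite /hom_density.
under eq_Rintegral do rewrite prodr_const.
rewrite (Rintegral_cst P (@measurable_cube01 R V) (q ^+ n)).
by rewrite [X in _ * X](_ : _ = 1) ?mulr1 //; exact: (congr1 fine (@tuple_prob_cube01 R V)).
Qed.

Lemma feasible_cst q : 0 <= q <= 1 -> LT_feasible E q (cst q).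
Proof. by move=> q01; split; [exact: graphon_cst|rewrite hom_density_cst]. Qed.

Lemma gap_integrable p q W : 0 < q <= p -> p <= 2^-1 ->
  64 * C * (p - q) <= q -> is_graphon W ->
  (mu01sq R).-integrable (@sq01 R) (EFin \o (gap C p q \o W)).
Proof.
move=> hq p2 pq gW; have /andP[q0 qp] := hq.
have C1 : 1 <= C by apply: exprn_ege1; lra.
have p2q : p <= 2 * q.
  have : p - q <= C * (p - q) by apply: ler_peMl => //; lra.
  lra.
set a := q * neg_slope p q.
have a0 : 0 <= a by rewrite mulr_ge0 ?(ltW q0) // neg_slope_ge0 //; lra.
have hp : 0 < p < 1 by lra.
apply: (mean_integrable gW (measurable_gap C p q)
  (M := p^-1 + (1 - p)^-1 + a)) => x hx; apply/andP; split.
  exact: gap_ge0.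
have I1 := Ip_le hp hx; have I2 : 0 <= Ip p q by apply: Ip_ge0 => //; lra.
have h0 : 0 <= penalty C p q x by apply: penalty_ge0 => //; lra.
have := mulr_ge0 a0 h0; rewrite /gap -/a; lra.
Qed.

(** The means of both sides of I_p = gap + q s h + (I_p(q) - q s), together with
    E[h(W)] >= 1 and s >= 0, where s is minus the slope of I_p at q. *)
Lemma mean_Ip_ge p q W : (0 < n)%N -> 0 < q <= p -> p <= 2^-1 ->
  64 * C * (p - q) <= q -> LT_feasible E q W ->
  Ip p q + mean (gap C p q) W <= mean (Ip p) W.
Proof.
move=> n0 hq p2 pq fW; have [gW _] := fW; have /andP[q0 qp] := hq.
have p0 : 0 < p by lra.
have C1 : 1 <= C by apply: exprn_ege1; lra.
have p2q : p <= 2 * q.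
  have : p - q <= C * (p - q) by apply: ler_peMl => //; lra.
  lra.
have pen := mean_penalty_ge1 n0 hq p2q fW.
set h := penalty C p q in pen *; set a := q * neg_slope p q.
have a0 : 0 <= a by rewrite mulr_ge0 ?(ltW q0) // neg_slope_ge0 //; lra.
have hp : 0 < p < 1 by lra.
have hb x : 0 <= x <= 1 -> 0 <= h x <= 2 + C.
  by move=> /andP[x0 _]; rewrite /h penalty_ge0 ?penalty_le //; lra.
have ig := gap_integrable hq p2 pq gW.
have ih := mean_integrable gW (measurable_penalty C p q) hb.
have c1 c : (mu01sq R).-integrable (@sq01 R) (EFin \o (fun=> c)).
  by apply: finite_measure_integrable_cst; exact: measurable_sq01.
have mS := @measurable_sq01 R.
have : mean (Ip p) W = mean (gap C p q) W + (a * mean h W + (Ip p q - a)).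
  have iah : (mu01sq R).-integrable (@sq01 R) (EFin \o (fun z => a * h (W z))).
    rewrite (_ : EFin \o _ = (fun z => a%:E * (EFin \o (h \o W)) z)%E) //.
    exact: integrableZl.
  have iahc : (mu01sq R).-integrable (@sq01 R)
      (EFin \o (fun z => a * h (W z) + (Ip p q - a))).
    rewrite (_ : EFin \o _ =
      (fun z => (a * h (W z))%R%:E + (Ip p q - a)%R%:E)%E) //.
    exact: (integrableD mS iah (c1 _)).
  transitivity (\int[mu01sq R]_(z in @sq01 R)
      (gap C p q (W z) + (a * h (W z) + (Ip p q - a)))).
    by apply: eq_Rintegral => z _; rewrite /gap -/a -/h; ring.
  rewrite RintegralD //.
  congr (_ + _); rewrite RintegralD // RintegralZl // Rintegral_cst //.
  congr (_ + _).
  rewrite [X in _ * X](_ : _ = 1) ?mulr1 //.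
  exact: (congr1 fine (@mu01sq_sq01 R)).
have := mulr_ge0 a0 (_ : 0 <= mean h W - 1); rewrite subr_ge0 => /(_ pen); lra.
Qed.

Lemma unique_minimizer_cst p q : (0 < n)%N -> 0 < q <= p -> p <= 2^-1 ->
  64 * C * (p - q) <= q -> LT_unique_minimizer E p q (cst q).
Proof.
move=> n0 hq p2 pq; have /andP[q0 qp] := hq.
have q01 : 0 <= q <= 1 by lra.
have C1 : 1 <= C by apply: exprn_ege1; lra.
have gap0 x : 0 <= x <= 1 -> 0 <= gap C p q x.
  exact: gap_ge0.
have mgap0 W : is_graphon W -> 0 <= mean (gap C p q) W.
  by move=> [_ W01 _]; apply: Rintegral_ge0 => -[x y] [/= Ix Iy]; exact/gap0/W01.
have minq : LT_minimizer E p q (cst q).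
  split=> [|U fU]; first exact: feasible_cst.
  rewrite mean_cst; have := mean_Ip_ge n0 hq p2 pq fU.
  have := mgap0 _ fU.1; lra.
split=> // U [fU minU]; apply: Relation_Operators.rst_step; split; [exact: fU.1|exact: graphon_cst|left].
have mean0 : mean (gap C p q) U = 0.
  have := minU _ minq.1; rewrite mean_cst.
  have := mean_Ip_ge n0 hq p2 pq fU; have := mgap0 _ fU.1; lra.
have ig := gap_integrable hq p2 pq fU.1.
have gU0 z : sq01 z -> 0 <= gap C p q (U z).
  by case: fU => -[_ U01 _] _; case: z => x y [/= Ix Iy]; exact/gap0/U01.
have : ae_eq (mu01sq R) (@sq01 R) (EFin \o (gap C p q \o U)) (cst 0%E).
  apply/(ae_eq_integral_abs _ (@measurable_sq01 R) (measurable_int _ ig)).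
  transitivity (\int[mu01sq R]_(z in @sq01 R) (EFin \o (gap C p q \o U)) z)%E.
    apply: eq_integral => z /set_mem hz.
    by rewrite /= ger0_norm // gU0.
  rewrite -[LHS]fineK; last by apply: integrable_fin_num ig; exact: measurable_sq01.
  by congr EFin.
apply: filterS => z gz hz; have {gz} [gz] := gz hz.
apply/eqP/negP => /negP Uq.
have : 0 < gap C p q (U z); last by rewrite gz ltxx.
apply: gap_gt0 => //; case: fU => -[_ U01 _] _.
by case: z hz {gz Uq} => x y [/= Ix Iy]; exact: U01.
Qed.

End NearP.

(** * Non-bipartite graphs and q near 0 *)

Section BipartiteGraphon.
Set Implicit Arguments.
Unset Strict Implicit.
Context (R : realType).
Implicit Types (p q : R) (z : R * R).

Definition left_half (x : R) : bool := x < 2^-1.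

Definition same_half z : bool := left_half z.1 == left_half z.2.

Definition bipartite_graphon p z : R := if same_half z then 0 else p.

Lemma measurable_same_half : measurable_fun (@setT (R * R)) same_half.
Proof.
have mh : measurable_fun [set: R] left_half by exact: measurable_fun_ltr.
pose l1 z := left_half z.1; pose l2 z := left_half z.2.
have m1 : measurable_fun setT l1 by exact: measurableT_comp.
have m2 : measurable_fun setT l2 by exact: measurableT_comp.
have -> : same_half = fun z => (l1 z && l2 z) || (~~ l1 z && ~~ l2 z).
  by apply/funext => z; rewrite /same_half -/(l1 z) -/(l2 z); case: (l1 z); case: (l2 z).
apply: measurable_or; apply: measurable_and => //; exact: measurable_neg.
Qed.

Lemma graphon_bipartite p : 0 <= p <= 1 -> is_graphon (bipartite_graphon p).
Proof.
move=> p01; split.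
- apply: measurable_funTS; apply: measurable_fun_ifT => //.
  exact: measurable_same_half.
- by move=> x y _ _; rewrite /bipartite_graphon; case: ifP; rewrite ?lexx ?ler01.
- by move=> x y _ _; rewrite /bipartite_graphon /same_half eq_sym.
Qed.

Lemma mu01sq_same_half : (mu01sq R (@sq01 R `&` same_half) <= (2^-1)%:E)%E.
Proof.
pose A : set R := `[0, 2^-1[%classic; pose B : set R := `[2^-1, 1]%classic.
have mA : measurable (A : set (measurableTypeR R)) by exact: measurable_itv.
have mB : measurable (B : set (measurableTypeR R)) by exact: measurable_itv.
have muA : mu01 R A = (2^-1)%:E.
  rewrite mu01E //; last first.
    by move=> x; rewrite /A /I01 /= !in_itv /= => /andP[x0 x1]; lra.
  by rewrite /A lebesgue_measure_itv /= lte_fin invr_gt0 ltr0n oppr0 adde0.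
have muB : mu01 R B = (2^-1)%:E.
  rewrite mu01E //; last first.
    by move=> x; rewrite /B /I01 /= !in_itv /= => /andP[x0 x1]; lra.
  rewrite /B lebesgue_measure_itv /= lte_fin ifT; last by lra.
  by rewrite -EFinD; congr EFin; lra.
have sq (D : set R) : measurable (D : set (measurableTypeR R)) ->
    mu01 R D = (2^-1)%:E -> mu01sq R (D `*` D) = (4^-1)%:E.
  move=> mD muD; transitivity (mu01 R D * mu01 R D)%E.
    exact: product_measure1E.
  by rewrite muD -EFinM; congr EFin; lra.
apply: (@le_trans _ _ (mu01sq R ((A `*` A) `|` (B `*` B)))).
  apply: le_measure; rewrite ?inE.
  - apply: measurableI; first exact: measurable_sq01.
    by rewrite -[X in measurable X]setTI; exact: measurable_same_half.
  - by apply: measurableU; exact: measurableX.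
  - move=> [x y] [[/= Ix Iy]]; move: Ix Iy.
    rewrite /I01 /A /B /same_half /left_half /= !in_itv /=.
    case: ltP => hx; case: ltP => hy // /andP[x0 x1] /andP[y0 y1] _.
      by left; rewrite x0 y0.
    by right; rewrite x1 y1.
apply: le_trans (measureU2 _ _ _) _; try exact: measurableX.
have -> : ((2^-1)%:E = (4^-1)%:E + (4^-1)%:E :> \bar R)%E.
  by rewrite -EFinD; congr EFin; lra.
by apply: leeD; [rewrite -(sq A mA muA)|rewrite -(sq B mB muB)]; exact: lexx.
Qed.

Lemma mean_Ip_bipartite p : 0 < p < 1 ->
  mean (Ip p) (bipartite_graphon p) <= 2^-1 * Ip p 0.
Proof.
move=> hp; have [p0 p1] := andP hp.
have I0 : 0 <= Ip p 0 by apply: Ip_ge0 => //; lra.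
have mS : measurable (same_half : set (measurableTypeR R * measurableTypeR R)).
  by rewrite -[X in measurable X]setTI; exact: measurable_same_half.
have mQ := @measurable_sq01 R.
have -> : mean (Ip p) (bipartite_graphon p) = \int[mu01sq R]_(z in @sq01 R)
    (Ip p 0 * \1_(same_half : set (R * R)) z).
  apply: eq_Rintegral => z _; rewrite /bipartite_graphon indicE.
  case: ifPn => hz; first by rewrite mem_set // mulr1.
  by rewrite memNset ?mulr0 ?Ippp //; exact/negP.
rewrite RintegralZl //; last first.
  apply: (@bounded_integrable _ _ _ _ _ _ 1) => // z _.
  by rewrite indicE; case: (_ \in _); rewrite lexx ler01.
rewrite mulrC ler_wpM2r //.
rewrite /Rintegral integral_indic //.
rewrite -lee_fin fineK; last by apply: fin_num_measure; exact: measurableI.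
by rewrite setIC; exact: mu01sq_same_half.
Qed.

(** Every point x of the cube two-colours the vertices by the half containing
    their coordinate; some edge is monochromatic and contributes a factor 0. *)
Lemma hom_density_bipartite (V : finType) (E : rel V) p :
  symmetric E -> irreflexive E -> ~ bipartite E ->
  hom_density E (bipartite_graphon p) = 0.
Proof.
move=> Esym Eirr nb; rewrite /hom_density.
transitivity (\int[tuple_prob (mu01 R) #|V|]_(x in @cube01 R V) (0 : R)).
  apply: eq_Rintegral => x _.
  have [u [v [Euv same]]] : exists u v, E u v /\
      left_half (vertex_coord x u) = left_half (vertex_coord x v).
    apply: contra_notP nb => H.
    exists [set u | left_half (vertex_coord x u)]%SET => u v Euv.
    rewrite !inE; apply/eqP => h; apply: H; by exists u, v.
  have [e eE e0] : exists2 e, e \in edges E & same_half (vertex_coord x e.1, vertex_coord x e.2).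
    have [uv|vu|uv] := ltngtP (enum_rank u) (enum_rank v).
    - by exists (u, v); rewrite /same_half /= ?same // inE Euv.
    - by exists (v, u); rewrite /same_half /= ?same // inE /= Esym Euv.
    - by move: Euv; rewrite (enum_rank_inj (val_inj uv)) Eirr.
  by rewrite (bigD1 e) //= /bipartite_graphon e0 mul0r.
by rewrite Rintegral_cst ?mul0r //; exact: measurable_cube01.
Qed.

End BipartiteGraphon.

Theorem theorem2p2 (R : realType) (V : finType) (E : rel V)
    (E_sym : symmetric E) (E_irr : irreflexive E)
    (E_edge : exists u v, E u v) :
  (exists qbar : R -> R,
    [/\ forall p, 0 < p < 1 -> 0 < qbar p < 1,
        exists2 l : R, l < 1 & qbar p / p @[p --> 0^'+] --> l &
        forall p q, 0 < p < 1 -> qbar p < q <= p ->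
          LT_unique_minimizer E p q (cst q)]) /\
  (~ bipartite E ->
   exists qlow : R -> R,
    [/\ forall p, 0 < p < 1 -> 0 < qlow p < 1,
        exists2 l : R, 0 < l & qlow p / p @[p --> 0^'+] --> l &
        forall p q, 0 < p < 1 -> 0 <= q < qlow p ->
          ~ LT_minimizer E p q (cst q)]).
Proof.
split.
  have n0 : (0 < #|edges E|)%N.
    have [u [v Euv]] := E_edge.
    have [uv|vu|uv] := ltngtP (enum_rank u) (enum_rank v).
    - by apply/card_gt0P; exists (u, v); rewrite inE Euv.
    - by apply/card_gt0P; exists (v, u); rewrite inE /= E_sym Euv.
    - by move: Euv; rewrite (enum_rank_inj (val_inj uv)) E_irr.
  (* q = c p solves K (p - q) = q, the limit case of the hypothesis of
     [unique_minimizer_cst]. *)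
  pose K : R := 64 * 4 ^+ #|edges E|.
  have K0 : 0 < K by rewrite mulr_gt0 // exprn_gt0.
  pose c := K / (K + 1).
  have c0 : 0 < c by rewrite divr_gt0 // addr_gt0.
  have c1 : c < 1 by rewrite ltr_pdivrMr ?mul1r ?ltrDl // addr_gt0.
  exists (fun p => if p <= 2^-1 then c * p else p); split.
  - move=> p /andP[p0 p1]; case: ifP => _; last by rewrite p0.
    rewrite mulr_gt0 //=; apply: le_lt_trans p1.
    by rewrite ler_piMl // ltW.
  - exists c => //; apply: cvg_near_cst.
    near=> p; have p0 : 0 < p by [].
    have -> : p <= 2^-1 by near: p; apply: nbhs_right_le.
    by rewrite mulfK // lt0r_neq0.
  - move=> p q /andP[p0 p1]; case: ifPn => [p2|_] /andP[hq qp]; last by lra.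
    have q0 : 0 < q by apply: lt_trans hq; rewrite mulr_gt0.
    apply: unique_minimizer_cst => //; first by rewrite q0.
    move: hq; rewrite /c mulrAC ltr_pdivrMr ?addr_gt0 // -/K => hq.
    lra.
move=> nb; exists (fun p => p / 100); split.
- move=> p /andP[p0 p1]; lra.
- exists (100^-1); first by rewrite invr_gt0.
  apply: cvg_near_cst; near=> p; have p0 : 0 < p by [].
  by rewrite mulrAC divff ?mul1r // lt0r_neq0.
move=> p q hp hq [_ /(_ (bipartite_graphon p))].
have p01 : 0 <= p <= 1 by lra.
have fb : LT_feasible E q (bipartite_graphon p).
  split; first exact: graphon_bipartite.
  by rewrite hom_density_bipartite // exprn_ge0 //; case/andP: hq.
move=> /(_ fb); rewrite mean_cst.
have := mean_Ip_bipartite hp; have := Ip_near0_gt hp hq; lra.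
Unshelve. all: by end_near.
Qed.
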